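(* Let $L$ be a bounded lattice and $\neg$ a protocomplementation on $L$. Then the map $a\mapsto\widehat{a}$ is (1) an embedding of $(L,\neg)$ into $(\mathfrak{L}(\mathsf{FI}(L,\neg)),\neg_\vartriangleleft)$ (an injective map preserving $0$, $1$, $\wedge$, $\vee$ and negation), and (2) an isomorphism from $L$ to the subalgebra of $(\mathfrak{L}(\mathsf{FI}(L,\neg)),\neg_\vartriangleleft)$ consisting of the $c_\vartriangleleft$-fixpoints that are compact open in the space $\mathsf{S}(L)$.
   Context: A protocomplementation is an antitone unary operation $\neg$ (i.e., $a\le b\Rightarrow\neg b\le\neg a$) with $a\wedge\neg a=0$ for all $a$ and $\neg0=1$. $\mathsf{FI}(L,\neg)=(X,\vartriangleleft)$ where $X$ is the set of pairs $(F,I)$ with $F$ a filter of $L$, $I$ an ideal of $L$, $F\cap I=\varnothing$, and $\{\neg a\mid a\in F\}\subseteq I$; and $(F,I)\vartriangleleft(F',I')$ iff $I\cap F'=\varnothing$. For $a\in L$, $\widehat{a}=\{(F,I)\in X\mid a\in F\}$. $\mathsf{S}(L)$ is $X$ with the topology generated by $\{\widehat{a}\mid a\in L\}$. For the frame $(X,\vartriangleleft)$ (write $y\vartriangleright x$ for $x\vartriangleleft y$): $c_\vartriangleleft(A)=\{x\mid\forall x'\vartriangleleft x\ \exists x''\vartriangleright x':x''\in A\}$; $\mathfrak{L}(X,\vartriangleleft)$ is the lattice of $c_\vartriangleleft$-fixpoints ($c_\vartriangleleft(A)=A$) ordered by inclusion, with meet $\cap$ and join $c_\vartriangleleft$ of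 the union; $\neg_\vartriangleleft A=\{x\mid\forall y\vartriangleleft x,\ y\notin A\}$. *)

(* Defs.v *)
From HB Require Import structures.
From mathcomp Require Import all_boot all_order.
From mathcomp Require Import boolp classical_sets functions.
From mathcomp Require Import topology_structure compact.

Set Implicit Arguments.
Unset Strict Implicit.
Unset Printing Implicit Defensive.

Local Open Scope classical_set_scope.

Section LatticesWithNegation.
Context {d : Order.disp_t} {L : tbLatticeType d}.
Implicit Types (neg : L -> L) (F I : set L) (a b : L).

Definition protocomplementation neg : Prop :=
  [/\ forall a b, (a <= b)%O -> (neg b <= neg a)%O,
      forall a, (a `&` neg a)%O = \bot%O
    & neg \bot%O = \top%O].

Definition lattice_filter F : Prop :=
  [/\ F !=set0,
      forall a b, (a <= b)%O -> F a -> F b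
    & forall a b, F a -> F b -> F (a `&` b)%O].

Definition lattice_ideal I : Prop :=
  [/\ I !=set0,
      forall a b, (a <= b)%O -> I b -> I a
    & forall a b, I a -> I b -> I (a `|` b)%O].

Definition subalgebra neg (S : set L) : Prop :=
  [/\ S \bot%O, S \top%O,
      forall a b, S a -> S b -> S (a `&` b)%O,
      forall a b, S a -> S b -> S (a `|` b)%O
    & forall a, S a -> S (neg a)].

End LatticesWithNegation.

Section Morphisms.
Context {d d' : Order.disp_t} {L : tbLatticeType d} {M : tbLatticeType d'}.
Variables (negL : L -> L) (negM : M -> M).

Definition neg_lattice_morphism (f : L -> M) : Prop :=
  [/\ f \bot%O = \bot%O,
      f \top%O = \top%O,
      Order.meet_morphism f,
      Order.join_morphism f
    & {morph f : a / negL a >-> negM a}].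

Definition neg_lattice_embedding (f : L -> M) : Prop :=
  neg_lattice_morphism f /\ injective f.

Definition neg_lattice_isom_onto (f : L -> M) (S : set M) : Prop :=
  [/\ subalgebra negM S, neg_lattice_morphism f & set_bij setT S f].

End Morphisms.

(* In a relational frame, [R x y] reads x ◁ y. *)
Section Fixpoints.
Context {X : Type}.
Implicit Types (R : X -> X -> Prop) (A B : set X).

Definition frame_closure R A : set X :=
  [set x | forall x', R x' x -> exists x'', R x' x'' /\ A x''].

Definition frame_neg R A : set X := [set x | forall y, R y x -> ~ A y].

Lemma frame_closure_incl R A : A `<=` frame_closure R A.
Proof. by move=> x Ax x' Rx'x; exists x. Qed.

Lemma frame_closureS R A B :
  A `<=` B -> frame_closure R A `<=` frame_closure R B.
Proof. by move=> AB x cAx x' /cAx[y [Ry /AB By]]; exists y. Qed.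

Lemma frame_closure_idem R A :
  frame_closure R (frame_closure R A) = frame_closure R A.
Proof.
apply/seteqP; split; last exact: frame_closure_incl.
by move=> x ccAx x' /ccAx[y [Ry cAy]]; exact: cAy.
Qed.

Lemma frame_closureT R : frame_closure R setT = setT.
Proof. by apply/seteqP; split=> // x _; exact: frame_closure_incl. Qed.

Lemma frame_closureI R A B :
  frame_closure R A = A -> frame_closure R B = B ->
  frame_closure R (A `&` B) = A `&` B.
Proof.
move=> cA cB; apply/seteqP; split; last exact: frame_closure_incl.
move=> x cABx; split; [rewrite -cA|rewrite -cB];
  by apply: frame_closureS cABx => y [].
Qed.

Lemma frame_neg_closed R A : frame_closure R (frame_neg R A) = frame_neg R A.
Proof.
apply/seteqP; split; last exact: frame_closure_incl.
by move=> x cx y /cx[z [Ryz nAz]]; exact: nAz.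
Qed.

(* The lattice 𝔏(X, ◁). *)
Record fixpoints R := Fixpoints {
  fp_set :> set X;
  fp_setP : frame_closure R fp_set = fp_set
}.

Definition fixpoints_neg R (A : fixpoints R) : fixpoints R :=
  Fixpoints (frame_neg_closed R A).

End Fixpoints.

Fact fixpoints_display : Order.disp_t. Proof. exact: Order.Disp tt tt. Qed.

Section FixpointLattice.
Context {X : Type} {R : X -> X -> Prop}.
Implicit Types A B C : fixpoints R.

Lemma fp_set_inj : injective (@fp_set X R).
Proof.
move=> [A cA] [B cB] /= AB; move: cA cB; rewrite AB => cA cB.
by rewrite (Prop_irrelevance cA cB).
Qed.

HB.instance Definition _ := gen_eqMixin (fixpoints R).
HB.instance Definition _ := gen_choiceMixin (fixpoints R).

Definition fix_le A B : bool := `[< A `<=` B >].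

Fact fix_le_refl : reflexive fix_le.
Proof. by move=> A; apply/asboolP. Qed.

Fact fix_le_anti : antisymmetric fix_le.
Proof.
by move=> A B /andP[/asboolP AB /asboolP BA]; apply/fp_set_inj/seteqP.
Qed.

Fact fix_le_trans : transitive fix_le.
Proof.
by move=> B A C /asboolP AB /asboolP BC; apply/asboolP; exact: subset_trans BC.
Qed.

HB.instance Definition _ := Order.Le_isPOrder.Build fixpoints_display
  (fixpoints R) fix_le_refl fix_le_anti fix_le_trans.

Definition fix_meet A B : fixpoints R :=
  Fixpoints (frame_closureI (fp_setP A) (fp_setP B)).

Definition fix_join A B : fixpoints R :=
  Fixpoints (frame_closure_idem R (A `|` B)).

Definition fix_bot : fixpoints R := Fixpoints (frame_closure_idem R set0).

Definition fix_top : fixpoints R := Fixpoints (frame_closureT R).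

Fact fix_meetP A B C :
  (A <= fix_meet B C)%O = (A <= B)%O && (A <= C)%O.
Proof.
apply/asboolP/andP => [ABC|[/asboolP AB /asboolP AC] x Ax].
  by split; apply/asboolP => x /ABC[].
by split; [exact: AB|exact: AC].
Qed.

Fact fix_joinP A B C :
  (fix_join A B <= C)%O = (A <= C)%O && (B <= C)%O.
Proof.
apply/asboolP/andP => [ABC|[/asboolP AC /asboolP BC]].
  by split; apply/asboolP => x Ax; apply: ABC;
    apply: frame_closure_incl; [left|right].
by rewrite -(fp_setP C); apply: frame_closureS => x [/AC|/BC].
Qed.

HB.instance Definition _ :=
  Order.POrder_MeetJoin_isLattice.Build fixpoints_display (fixpoints R)
    fix_meetP fix_joinP.

Fact fix_le0 A : (fix_bot <= A)%O.
Proof.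
by apply/asboolP; rewrite -(fp_setP A); apply: frame_closureS; exact: sub0set.
Qed.

Fact fix_le1 A : (A <= fix_top)%O.
Proof. exact/asboolP. Qed.

HB.instance Definition _ :=
  Order.hasBottom.Build fixpoints_display (fixpoints R) fix_le0.
HB.instance Definition _ :=
  Order.hasTop.Build fixpoints_display (fixpoints R) fix_le1.

End FixpointLattice.

Section FilterIdealFrame.
Context {d : Order.disp_t} {L : tbLatticeType d}.

Record filter_ideal (neg : L -> L) := FilterIdeal {
  fi_filter : set L;
  fi_ideal : set L;
  fi_filterP : lattice_filter fi_filter;
  fi_idealP : lattice_ideal fi_ideal;
  fi_disj : fi_filter `&` fi_ideal = set0;
  fi_neg : neg @` fi_filter `<=` fi_ideal
}.

Variable neg : L -> L.

Definition fi_rel (x y : filter_ideal neg) : Prop :=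
  fi_ideal x `&` fi_filter y = set0.

Definition fi_hat (a : L) : set (filter_ideal neg) := [set x | fi_filter x a].

HB.instance Definition _ := gen_eqMixin (filter_ideal neg).
HB.instance Definition _ := gen_choiceMixin (filter_ideal neg).

(* The topology of S(L), generated by the sets [fi_hat a]. *)
HB.instance Definition _ :=
  @isSubBaseTopological.Build (filter_ideal neg) (set (filter_ideal neg))
    (range fi_hat) id.

Definition compact_open_fixpoints : set (fixpoints fi_rel) :=
  [set A | compact (A : set (filter_ideal neg)) /\
           open (A : set (filter_ideal neg))].

End FilterIdealFrame.

Arguments fi_rel {d L} neg x y.
Arguments fi_hat {d L} neg a.
Arguments compact_open_fixpoints {d L} neg.

(* Main.v *)
Require Import Defs.
From mathcomp Require Import all_boot all_order finmap.
From mathcomp Require Import boolp classical_sets filter.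
From mathcomp Require Import topology_structure compact.

(** The pairs of a principal filter and a principal ideal do all the work:
    [(↑⊤, ↓a)] separates [a] from any point whose filter misses [a], so [â] is a
    fixpoint; [(↑a, ↓¬a)], which exists as soon as [a <> ⊥], witnesses the
    preservation of joins and negation and the injectivity. Every neighborhood of
    [(↑a, ↓¬a)] contains [â], whence the compactness of [â]. Conversely, an open
    set is a union of sets [â], and if it is moreover a compact fixpoint, then
    finitely many of them suffice, since a fixpoint that contains [â] and [b̂]
    contains the hat of [a ∨ b]. *)

Set Implicit Arguments.
Unset Strict Implicit.
Unset Printing Implicit Defensive.

Import Order.LTheory.

Local Open Scope classical_set_scope.
Local Open Scope order_scope.

Section Protocomplementation.
Context {d : Order.disp_t} {L : tbLatticeType d}.
Implicit Types (a b : L).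

Lemma lattice_filter_top (F : set L) : lattice_filter F -> F \top.
Proof. by case=> -[a Fa] FS _; exact: FS (lex1 a) Fa. Qed.

Lemma lattice_ideal_bot (I : set L) : lattice_ideal I -> I \bot.
Proof. by case=> -[a Ia] IS _; exact: IS (le0x a) Ia. Qed.

Lemma lattice_filter_principal a : lattice_filter [set b | a <= b].
Proof.
split=> [|b c bc ab|b c ab ac] /=; first by exists a => /=.
- exact: le_trans bc.
- by rewrite lexI ab ac.
Qed.

Lemma lattice_ideal_principal a : lattice_ideal [set b | b <= a].
Proof.
split=> [|b c bc ca|b c ba ca] /=; first by exists a => /=.
- exact: le_trans ca.
- by rewrite leUx ba ca.
Qed.

Context {neg : L -> L} (hneg : protocomplementation neg).
Implicit Types (x y : filter_ideal neg).

Lemma protocomplementation_top : neg \top = \bot.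
Proof. by case: hneg => _ + _ => /(_ \top); rewrite meet1x. Qed.

(** For [a <> \bot] this makes [↑a] and [↓(neg a)] disjoint. *)
Lemma le_protocomplement a : (a <= neg a) = (a == \bot).
Proof.
case: hneg => _ aNa _; apply/idP/eqP => [/meet_l <-|->]; last exact: le0x.
exact: aNa.
Qed.

(** An element in both sets would force [a <= b]. Antitonicity gives [neg c <= neg a <= b] for every
    [c >= a]. *)
Lemma exists_principal_point a b : neg a <= b -> ~~ (a <= b) ->
  exists x, fi_filter x = [set c | a <= c] /\ fi_ideal x = [set c | c <= b].
Proof.
case: hneg => negS _ _ nab ab.
have disj : [set c | a <= c] `&` [set c | c <= b] = set0 :> set L.
  by apply/seteqP; split=> // c [/= ac cb]; move: ab; rewrite (le_trans ac cb).
have negI : neg @` [set c | a <= c] `<=` [set c | c <= b].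
  by move=> _ [c /= ac <-]; exact: le_trans (negS _ _ ac) nab.
by exists (FilterIdeal (lattice_filter_principal a) (lattice_ideal_principal b)
  disj negI).
Qed.

Lemma fi_relP x y : fi_rel neg x y <-> forall a, fi_ideal x a -> ~ fi_filter y a.
Proof.
split=> [xy a Ia Fa|xy]; last by apply/seteqP; split=> // a [/xy].
by have : set0 a by rewrite -xy.
Qed.

Lemma fi_rel_refl x : fi_rel neg x x.
Proof. by rewrite /fi_rel setIC; exact: fi_disj. Qed.

Lemma fi_hat0 : fi_hat neg \bot = set0.
Proof.
apply/seteqP; split=> // x F0.
exact: (fi_relP x x).1 (fi_rel_refl x) _ (lattice_ideal_bot (fi_idealP x)) F0.
Qed.

Lemma fi_hat1 : fi_hat neg \top = setT.
Proof.
by apply/seteqP; split=> // x _; exact: lattice_filter_top (fi_filterP x).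
Qed.

Lemma fi_hatS a b : a <= b -> fi_hat neg a `<=` fi_hat neg b.
Proof. by move=> ab x; case: (fi_filterP x) => _ FS _; exact: FS. Qed.

Lemma fi_hatI a b : fi_hat neg (a `&` b) = fi_hat neg a `&` fi_hat neg b.
Proof.
apply/seteqP; split=> [x abx|x [ax bx]].
  by split; apply: fi_hatS abx; [exact: leIl|exact: leIr].
by case: (fi_filterP x) => _ _; apply.
Qed.

Lemma exists_generic_point a : a != \bot -> exists x,
  fi_filter x = [set c | a <= c] /\ fi_ideal x = [set c | c <= neg a].
Proof.
by move=> a0; apply: exists_principal_point; rewrite // le_protocomplement.
Qed.

Lemma fi_hat_closed a : frame_closure (fi_rel neg) (fi_hat neg a) = fi_hat neg a.
Proof.
apply/seteqP; split; last exact: frame_closure_incl.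
move=> x cx; apply: contrapT => nxa.
(* The pair [(↑⊤, ↓a)] is related to [x], since an element of the filter of [x] below [a] would put
   [a] in it; no successor of this pair lies in [fi_hat neg a]. *)
have [||y [_ Iy]] := @exists_principal_point \top a.
- by rewrite protocomplementation_top le0x.
- apply/negP => ta; apply: nxa.
  by apply: fi_hatS ta _ _; rewrite fi_hat1.
have [|z [/fi_relP yz za]] := cx y.
  apply/fi_relP => c; rewrite Iy /= => ca xc; apply: nxa.
  exact: fi_hatS ca _ xc.
by apply: (yz a) za; rewrite Iy /=.
Qed.

Lemma fi_hatU a b : fi_hat neg (a `|` b) =
  frame_closure (fi_rel neg) (fi_hat neg a `|` fi_hat neg b).
Proof.
(* The successor is [(↑c, ↓(neg c))]: an element of [fi_ideal y] above [c] would put [c] in that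
   ideal. *)
have step c y : ~ fi_ideal y c ->
    exists z, fi_rel neg y z /\ fi_hat neg c z.
  move=> nyc; have [|z [Fz _]] := @exists_generic_point c.
    apply/eqP => c0; apply: nyc; rewrite c0.
    exact: lattice_ideal_bot (fi_idealP y).
  exists z; split; last by rewrite /fi_hat /= Fz /=.
  apply/fi_relP => e ye; rewrite Fz /= => ce; apply: nyc.
  by case: (fi_idealP y) => _ IS _; exact: IS ye.
apply/seteqP; split=> [x xab y /fi_relP yx|].
  (* The ideal of [y] cannot contain both [a] and [b], as it would then meet the filter of [x] at
     the join. *)
  have [ya|/step[z [yz za]]] := pselect (fi_ideal y a);
    last by exists z; split; [|left].
  have [yb|/step[z [yz zb]]] := pselect (fi_ideal y b);
    last by exists z; split; [|right].
  case: (yx (a `|` b)) => //.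
  by case: (fi_idealP y) => _ _; apply.
rewrite -[X in _ `<=` X]fi_hat_closed; apply: frame_closureS => x [].
  exact/fi_hatS/leUl.
exact/fi_hatS/leUr.
Qed.

Lemma fi_hatN a : fi_hat neg (neg a) = frame_neg (fi_rel neg) (fi_hat neg a).
Proof.
apply/seteqP; split=> [x xna y /fi_relP yx ya|x nx].
  by apply: yx xna; apply: fi_neg; exists a.
(* When [neg a] is not in the filter of [x], the pair [(↑a, ↓(neg a))] is related to [x] and lies in
   [fi_hat neg a]. *)
apply: contrapT => xna; have [|y [Fy Iy]] := @exists_generic_point a.
  case: hneg => _ _ neg0; apply/eqP => a0; apply: xna.
  by rewrite a0 neg0 fi_hat1.
apply: (nx y); last by rewrite /fi_hat /= Fy /=.
apply/fi_relP => c; rewrite Iy /= => cna xc; apply: xna.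
exact: fi_hatS cna _ xc.
Qed.

Lemma fi_hat_le a b : fi_hat neg a `<=` fi_hat neg b -> a <= b.
Proof.
move=> ab; have [->|/exists_generic_point[x [Fx _]]] := eqVneq a \bot.
  exact: le0x.
by have := ab x; rewrite /fi_hat /= Fx /=; exact.
Qed.

Lemma open_fi_hat a : open (fi_hat neg a).
Proof.
exists [set fi_hat neg a]; last by rewrite bigcup_set1.
by move=> _ ->; apply: finI_from1; exists a.
Qed.

(** Hats are closed under finite meets, with [\top] for the empty family, so the subbase is in fact
    a base. *)
Lemma fi_hat_bigcap x (s : seq (set (filter_ideal neg))) :
  (forall A, A \in s -> range (fi_hat neg) A) -> (forall A, A \in s -> A x) ->
  exists2 a, fi_hat neg a x & forall A, A \in s -> fi_hat neg a `<=` A.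
Proof.
elim: s => [|A s IH] shat sx; first by exists \top; rewrite ?fi_hat1.
have [B sB|B sB|a xa aS] := IH.
- by apply: shat; rewrite inE sB orbT.
- by apply: sx; rewrite inE sB orbT.
have [c _ cA] := shat A (mem_head _ _).
exists (c `&` a); rewrite fi_hatI.
  by split=> //; rewrite cA; exact: sx (mem_head _ _).
move=> B; rewrite inE => /predU1P[->|/aS aB] y [cy ay]; last exact: aB.
by rewrite -cA.
Qed.

Lemma nbhs_fi_hat x (B : set (filter_ideal neg)) :
  nbhs x B -> exists2 a, fi_hat neg a x & fi_hat neg a `<=` B.
Proof.
rewrite nbhsE => -[U [[D' D'base <-] [V D'V Vx]] UB].
have /= [S Shat SV] := D'base _ D'V.
have [A /Shat|A SA|a xa aS] := @fi_hat_bigcap x (enum_fset S).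
- by rewrite inE.
- by rewrite -SV in Vx; exact: Vx.
exists a => // y ya; apply: UB; exists V => //.
suff : (V : set (filter_ideal neg)) y by [].
by rewrite -SV => A SA; exact: aS SA _ ya.
Qed.

Lemma compact_fi_hat a : compact (fi_hat neg a).
Proof.
have [->|/exists_generic_point[x [Fx _]]] := eqVneq a \bot.
  by rewrite fi_hat0; exact: compact0.
have hatP c : fi_hat neg c x <-> a <= c by rewrite /fi_hat /= Fx.
(* The generic point [x] is a cluster point of every proper filter containing [fi_hat neg a]. *)
move=> F FF Fa; exists x; split; first exact/hatP.
move=> A B FA /nbhs_fi_hat[c /hatP ac cB].
have [y [Ay ya]] := filter_ex (filterI FA Fa).
by exists y; split=> //; apply/cB/(fi_hatS ac).
Qed.

(* If [A] is not some [â], then the sets [A `\` â] with [â `<=` A] form a proper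
   filter base: it is closed under intersections because [A] is a fixpoint. *)
Lemma compact_open_fixpoint_hat (A : set (filter_ideal neg)) :
  frame_closure (fi_rel neg) A = A -> compact A -> open A ->
  exists a, fi_hat neg a = A.
Proof.
move=> cA coA oA; apply: contrapT => nA.
pose F : set_system (filter_ideal neg) :=
  filter_from [set a | fi_hat neg a `<=` A] (fun a => A `\` fi_hat neg a).
have FF : ProperFilter F.
  apply: filter_from_proper => [|a aA].
    apply: filter_from_filter => [|a b aA bA].
      by exists \bot; rewrite /= fi_hat0.
    exists (a `|` b) => /=.
      by rewrite fi_hatU -cA; apply: frame_closureS => x [/aA|/bA].
    move=> x [Ax nx]; split; split=> // hx; apply: nx.
      exact: fi_hatS (leUl _ _) _ hx.
    exact: fi_hatS (leUr _ _) _ hx.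
  apply: contrapT => A0; apply: nA; exists a; apply/seteqP; split=> // x Ax.
  by apply: contrapT => nx; apply: A0; exists x.
have FA : F A.
  by exists \bot; rewrite /= fi_hat0; [exact: sub0set|exact: subDsetl].
(* Openness gives a hat around the cluster point [x] inside [A]. Its complement in [A] belongs to
   [F], so the two should meet, which is absurd. *)
have [x [Ax clx]] := coA F FF FA.
have [a xa aA] := nbhs_fi_hat (open_nbhs_nbhs (conj oA Ax)).
have [||y [[_ ny] ya]] := clx (A `\` fi_hat neg a) (fi_hat neg a).
- by exists a.
- exact: open_nbhs_nbhs (conj (open_fi_hat a) xa).
exact: ny.
Qed.

Definition hat a : fixpoints (fi_rel neg) := Fixpoints (fi_hat_closed a).

Lemma hat_morphism :
  neg_lattice_morphism neg (@fixpoints_neg _ (fi_rel neg)) hat.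
Proof.
split=> [||a b|a b|a]; apply: fp_set_inj => /=.
(* By reflexivity of the relation, a point in the closure of the empty set would need a successor in
   the empty set. *)
- rewrite fi_hat0; apply/seteqP; split=> // x /(_ x (fi_rel_refl x)).
  by case=> y [].
- exact: fi_hat1.
- exact: fi_hatI.
- exact: fi_hatU.
- exact: fi_hatN.
Qed.

Lemma hat_inj : injective hat.
Proof.
move=> a b /(congr1 (@fp_set _ _)) /= ab.
by apply: le_anti; apply/andP; split; apply: fi_hat_le; rewrite ab.
Qed.

Lemma compact_open_fixpointsE : compact_open_fixpoints neg = range hat.
Proof.
apply/seteqP; split=> [A [coA oA]|_ [a _ <-]].
  have [a aA] := compact_open_fixpoint_hat (fp_setP A) coA oA.
  by exists a => //; exact: fp_set_inj.
by split; [exact: compact_fi_hat|exact: open_fi_hat].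
Qed.

End Protocomplementation.

Lemma subalgebra_range {d d' : Order.disp_t} {L : tbLatticeType d}
    {M : tbLatticeType d'} (negL : L -> L) (negM : M -> M) (f : L -> M) :
  neg_lattice_morphism negL negM f -> subalgebra negM (range f).
Proof.
case=> f0 f1 fI fU fN; split.
- by exists \bot.
- by exists \top.
- by move=> _ _ [a _ <-] [b _ <-]; exists (a `&` b)%O; rewrite ?fI.
- by move=> _ _ [a _ <-] [b _ <-]; exists (a `|` b)%O; rewrite ?fU.
- by move=> _ [a _ <-]; exists (negL a); rewrite ?fN.
Qed.

Theorem theorem4p30 (d : Order.disp_t) (L : tbLatticeType d) (neg : L -> L)
    (hneg : protocomplementation neg) :
  exists hat : L -> fixpoints (fi_rel neg),
    [/\ forall a : L, fp_set (hat a) = fi_hat neg a,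
        neg_lattice_embedding neg (@fixpoints_neg _ (fi_rel neg)) hat
      & neg_lattice_isom_onto neg (@fixpoints_neg _ (fi_rel neg)) hat
          (compact_open_fixpoints neg)].
Proof.
have hatM := hat_morphism hneg; exists (hat hneg); split=> //.
  by split=> //; exact: hat_inj.
(* As the range of a morphism, the set of compact open fixpoints is a subalgebra; closure under the
   operations needs no topological argument. *)
rewrite (compact_open_fixpointsE hneg); split=> //.
  exact: subalgebra_range hatM.
split=> [a _|a b _ _|A [a _ <-]]; [by exists a|exact: hat_inj|by exists a].
Qed.
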